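(* For every meager set $F\subseteq 2^\omega$ there is a splitting tree $T\subseteq 2^{<\omega}$ such that for every $n\in\omega$ the set $$F+\underbrace{[T]+[T]+\dots+[T]}_{n\text{ times}}$$ is meager in $2^\omega$.
   Context: A tree is a nonempty set $T\subseteq 2^{<\omega}$ closed under initial segments, and $[T]=\{x\in 2^\omega:(\forall n\in\omega)\ x\upharpoonright n\in T\}$. $T$ is a splitting tree if $(\forall\sigma\in T)(\exists N\in\omega)(\forall n>N)(\forall i\in\{0,1\})(\exists\tau\in T)(\sigma\subseteq\tau\ \wedge\ \tau(n)=i)$. On $2^\omega$, $+$ is coordinatewise addition modulo $2$, and $A+B=\{a+b:a\in A,\ b\in B\}$ for $A,B\subseteq 2^\omega$; for $n=0$ the displayed set is read as $F$ itself. *)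

(* Defs.v *)
From mathcomp Require Import all_boot.
From mathcomp Require Import boolp classical_sets topology cantor.

Set Implicit Arguments.
Unset Strict Implicit.
Unset Printing Implicit Defensive.

Local Open Scope classical_set_scope.

Definition nowhere_dense (X : topologicalType) (A : set X) : Prop :=
  interior (closure A) = set0.

Definition meager (X : topologicalType) (A : set X) : Prop :=
  exists N : nat -> set X,
    (forall k, nowhere_dense (N k)) /\ A = \bigcup_k N k.

Definition cantor_add (x y : cantor_space) : cantor_space :=
  fun k => x k (+) y k.

Definition set_add (A B : set cantor_space) : set cantor_space :=
  [set cantor_add a b | a in A & b in B].

(* The sum A + B + ... + B with n summands B, associated to the left. *)
Definition add_iter (A B : set cantor_space) (n : nat) : set cantor_space :=
  iter n (fun C => set_add C B) A.

Definition is_tree (T : set (seq bool)) : Prop :=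
  T !=set0 /\ forall s t : seq bool, prefix s t -> T t -> T s.

(* [mkseq x n] is the restriction of x to n. *)
Definition branches (T : set (seq bool)) : set cantor_space :=
  [set x | forall n : nat, T (mkseq x n)].

(* [onth t n = Some i] says that n is in the domain of t and t(n) = i. *)
Definition splitting_tree (T : set (seq bool)) : Prop :=
  is_tree T /\
  forall s, T s -> exists N : nat, forall n : nat, (N < n)%N ->
    forall i : bool, exists t, [/\ T t, prefix s t & onth t n = Some i].

(* Main.v *)
Require Import Defs.
From mathcomp Require Import all_boot.
From mathcomp Require Import boolp classical_sets topology cantor.
From mathcomp Require Import zify.

Set Implicit Arguments.
Unset Strict Implicit.
Unset Printing Implicit Defensive.

Local Open Scope classical_set_scope.

(** Cut the coordinates into consecutive finite blocks I_k. If the lengths grow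
    fast enough there is a single point z which defeats every nowhere dense
    piece N_j of F at once: a point of N_j differs from z somewhere on I_k for
    every k >= j ([dodging_blocks]). Conversely, group the blocks into
    superblocks J_m, where J_m is the union of the I_k with
    m^2 <= k < (m+1)^2; a set of points which, for all large m, differ from z
    on at least one block of J_m is nowhere dense, since any finite string can
    be prolonged so as to copy z on all of some J_m
    ([avoidable_eventually_mismatched]).

    The tree T consists of the strings with at most one 1 in each J_m. It is
    splitting: after a string s, pad with zeros up to any coordinate beyond the
    superblock where s ends, and put there the required bit
    ([sparse_tree_splitting]). Adding n branches of T to a point y alters at
    most n coordinates in each J_m, whereas J_m has 2m+1 blocks. Hence, for
    m >= n, some block of J_m is left intact ([unchanged_block]). If y is in
    N_j and m >= j, then on that block the sum still differs from z. So every
    element of F + n[T] differs from z on a block of J_m for all large m, and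
    these points form a countable union of nowhere dense sets. *)

(** * Nowhere dense sets in terms of finite strings *)

Definition agree (a b : nat) (x y : cantor_space) : Prop :=
  forall i, a <= i < b -> x i = y i.

(** Nowhere density in terms of finite strings. A string of length a is encoded
    as the restriction to a of a point x, so that prolonging it amounts to
    changing the point beyond a and no concatenation is needed. *)
Definition avoidable (A : set cantor_space) : Prop :=
  forall x a, exists y b,
    [/\ a <= b, agree 0 a x y & forall w, agree 0 b w y -> ~ A w].

Lemma nbhs_agree (x : cantor_space) L : nbhs x [set w | agree 0 L w x].
Proof.
elim: L => [|L IH].
  by apply: filterS filterT => w _ i; rewrite ltn0 andbF.
have HL : nbhs x [set w : cantor_space | w L = x L].
  have := @proj_continuous nat (fun=> bool) L x [set x L].
  apply; exact: discrete_set1.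
apply: filterS (filterI IH HL) => w [wx wL] i /andP[_ iL].
have [->//|iL'] := eqVneq i L.
by apply: wx; lia.
Qed.

(** The cylinders around x generate a filter which converges to x coordinate by
    coordinate, hence in the product topology. *)
Lemma nbhs_cylinder (x : cantor_space) (U : set cantor_space) :
  nbhs x U -> exists L, [set w | agree 0 L w x] `<=` U.
Proof.
pose G : set_system cantor_space :=
  filter_from setT (fun L => [set w | agree 0 L w x]).
have GF : Filter G.
  apply: filter_from_filter; first by exists 0.
  move=> a b _ _; exists (maxn a b) => // w wx; split=> i /andP[_ iab];
    by apply: wx; rewrite leq_max iab ?orbT.
have : G --> (x : prod_topology (fun _ : nat => bool)).
  apply/cvg_sup => i V; rewrite nbhsE => -[B [[C oC <-] Cx] BV].
  exists i.+1 => // w wx; apply: BV => /=.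
  suff -> : w i = x i by [].
  by apply: wx; rewrite ltnSn.
by move=> H /H [L _ LU]; exists L.
Qed.

Lemma nowhere_dense_avoidable (A : set cantor_space) :
  nowhere_dense A -> avoidable A.
Proof.
move=> nA x a; apply: contrapT => H.
suff : interior (closure A) x by rewrite nA.
apply: filterS (nbhs_agree x a) => w wx U /nbhs_cylinder[L LU].
apply: contrapT => AU; apply: H; exists w, (maxn a L); split.
- exact: leq_maxl.
- by move=> i /wx.
move=> v vw Av; apply: AU; exists v; split => //; apply: LU => i /andP[_ iL].
by apply: vw; rewrite leq_max iL orbT.
Qed.

Lemma avoidable_nowhere_dense (A : set cantor_space) :
  avoidable A -> nowhere_dense A.
Proof.
move=> aA; rewrite /nowhere_dense -subset0 => x /nbhs_cylinder[a aU].
have [y [b [ab xy yA]]] := aA x a.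
have /aU /(_ _ (nbhs_agree y b)) [w [Aw wy]] : [set w | agree 0 a w x] y.
  by move=> i /xy.
exact: yA wy Aw.
Qed.

Lemma avoidableU (A B : set cantor_space) :
  avoidable A -> avoidable B -> avoidable (A `|` B).
Proof.
move=> aA aB x a.
have [y [b [ab xy yA]]] := aA x a.
have [z [c [bc yz zB]]] := aB y b.
exists z, c; split; first exact: leq_trans bc.
  move=> i /andP[_ ia]; rewrite xy // yz //; exact: leq_trans ab.
move=> w wz [Aw|]; last exact: zB.
apply: yA Aw => i /andP[_ ib]; rewrite yz ?ib // wz //; exact: leq_trans bc.
Qed.

Lemma avoidable_bigcup (A : nat -> set cantor_space) k :
  (forall j, avoidable (A j)) ->
  avoidable [set x | exists2 j, j <= k & A j x].
Proof.
move=> aA; elim: k => [|k IH].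
  move=> x a; have [y [b [ab xy yA]]] := aA 0 x a; exists y, b; split=> //.
  by move=> w wy [j]; rewrite leqn0 => /eqP ->; apply: yA.
move=> x a; have [y [b [ab xy yA]]] := avoidableU IH (aA k.+1) x a.
exists y, b; split=> // w wy [j jk Aj]; apply: (yA w wy).
by move: jk; rewrite leq_eqVlt => /orP[/eqP <-|jk]; [right|left; exists j].
Qed.

(** * Blocks on which one point defeats all the pieces *)

(** Unlike in the definition of [avoidable], the string that y prescribes on
    [a, b[ works whatever the first a bits are. There are only finitely many
    possibilities for these bits, and the string is prolonged to take care of
    each in turn; this is organised as an induction on the number of free bits,
    treating both values of the last free bit at each step. *)
Lemma avoidable_block (A : set cantor_space) a : avoidable A ->
  exists y b, a < b /\ forall w, agree a b w y -> ~ A w.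
Proof.
move=> aA.
(* The induction needs to prolong a string which is already prescribed on
   [a, a'[, by some x; starting from a' = a + 1 makes the block nonempty. *)
suff [y [b [ab _ yA]]] : exists y b, [/\ a.+1 <= b,
    agree a a.+1 (fun=> false) y & forall w, agree a b w y -> ~ A w].
  by exists y, b.
move: (fun=> false) (a.+1) (leqnSn a) => x a'.
elim: a x a' => [|a IH] x a' aa'; first exact: aA.
pose set_bit v (y : cantor_space) : cantor_space :=
  fun i => if i == a then v else y i.
have [y [b [ab xy yA]]] := IH (set_bit false x) a' (ltnW aa').
have [z [c [bc yz zA]]] := IH (set_bit true y) b (leq_trans (ltnW aa') ab).
exists z, c; split; first exact: leq_trans bc.
  move=> i /andP[ai ia'].
  have ia : (i == a) = false by lia.
  have -> : x i = y i by rewrite -xy /set_bit ?ia //; lia.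
  by rewrite -yz /set_bit ?ia //; lia.
move=> w wz; case wa : (w a).
  apply: zA => i /andP[ai ic].
  have [ia|ia] := eqVneq i a; last by apply: wz; lia.
  by rewrite -yz /set_bit ia ?eqxx //; lia.
apply: yA => i /andP[ai ib].
have [ia|ia] := eqVneq i a.
  by rewrite -xy /set_bit ia ?eqxx //; lia.
have -> : y i = z i by rewrite -yz /set_bit ?(negbTE ia) //; lia.
by apply: wz; lia.
Qed.

Lemma increasing_leq (c : nat -> nat) : (forall k, c k < c k.+1) ->
  {homo c : k l / k <= l}.
Proof. by move=> cS; apply: homo_leq leq_trans _ => // k; apply: ltnW. Qed.

Lemma increasing_geq (c : nat -> nat) : (forall k, c k < c k.+1) ->
  forall k, k <= c k.
Proof. by move=> cS; elim=> // k IH; apply: leq_ltn_trans (cS k). Qed.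

Lemma block_unique (c : nat -> nat) k l i : (forall k, c k < c k.+1) ->
  c k <= i < c k.+1 -> c l <= i < c l.+1 -> k = l.
Proof.
move=> cS ik il; have cle := increasing_leq cS.
by have [kl|lk|//] := ltngtP k l; [have := cle _ _ kl|have := cle _ _ lk]; lia.
Qed.

Lemma glue_blocks (c : nat -> nat) (y : nat -> cantor_space) :
  (forall k, c k < c k.+1) ->
  exists z : cantor_space, forall k, agree (c k) (c k.+1) z (y k).
Proof.
move=> cS.
have [i|z zP] := @choice nat bool
    (fun i v => forall k, c k <= i < c k.+1 -> v = y k i).
  have [[k ik]|nk] := pselect (exists k, c k <= i < c k.+1).
    by exists (y k i) => l il; rewrite (block_unique cS ik il).
  by exists false => k ik; case: nk; exists k.
by exists z => k i ik; apply: zP.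
Qed.

(** The k-th block is chosen to defeat A 0, ..., A k simultaneously. *)
Lemma dodging_blocks (A : nat -> set cantor_space) :
  (forall j, avoidable (A j)) ->
  exists (c : nat -> nat) (z : cantor_space), (forall k, c k < c k.+1) /\
    forall j k w, j <= k -> A j w -> ~ agree (c k) (c k.+1) w z.
Proof.
move=> aA.
have [p|g gP] := @choice (nat * nat) (cantor_space * nat) (fun p q =>
    p.2 < q.2 /\ forall w, agree p.2 q.2 w q.1 ->
      ~ [set x | exists2 j, j <= p.1 & A j x] w).
  have [y [b yb]] := avoidable_block p.2 (avoidable_bigcup p.1 aA).
  by exists (y, b).
pose c := fix c k := if k is k'.+1 then (g (k', c k')).2 else 0.
have cS k : c k < c k.+1 by have [] := gP (k, c k).
have [z zP] := glue_blocks (fun k => (g (k, c k)).1) cS.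
exists c, z; split=> // j k w jk Ajw wz.
have [_ /(_ w)] := gP (k, c k); apply; last by exists j.
by move=> i ik; rewrite (wz i) // (zP k).
Qed.

(** * The tree of strings with at most one 1 per superblock *)

(** As [nth] defaults to false, positions past the end of s count as zeros. *)
Definition sparse_tree (d : nat -> nat) : set (seq bool) :=
  [set s | forall m i j, d m <= i < d m.+1 -> d m <= j < d m.+1 ->
    nth false s i -> nth false s j -> i = j].

Lemma sparse_tree_splitting (d : nat -> nat) :
  (forall m, d m < d m.+1) -> splitting_tree (sparse_tree d).
Proof.
move=> dS; split; [split|].
- by exists [::] => m i j _ _; rewrite nth_nil.
- move=> s t /prefixP[u ->] Tt m i j im jm si sj.
  have in_s k : nth false s k -> nth false (s ++ u) k.
    by rewrite nth_cat; case: ltnP => // ks; rewrite nth_default.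
  by apply: (Tt m); rewrite ?in_s.
move=> s Ts; exists (d (size s)) => n sn v.
have size_n : size s <= n by apply: leq_trans (increasing_geq dS _) (ltnW sn).
pose t := s ++ rcons (nseq (n - size s) false) v.
have tE i : nth false t i -> i < size s /\ nth false s i \/ i = n.
  rewrite /t nth_cat; case: ltnP => [|si]; first by left.
  rewrite nth_rcons size_nseq nth_nseq; case: ltnP => //.
  by case: eqP => // ? _ _; right; lia.
have late m i : i < size s -> d m <= i -> d m.+1 <= n.
  move=> ims dmi; have ms : m < size s.
    by apply: leq_ltn_trans ims; apply: leq_trans dmi; apply: increasing_geq.
  by apply: leq_trans (ltnW sn); apply: increasing_leq.
(* The padded string has its new bit in a superblock that contains no position
   of s, so at most one 1 per superblock is preserved. *)
exists t; split.
- move=> m i j im jm /tE[[li si]|i_n] /tE[[lj sj]|j_n].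
  + exact: (Ts m).
  + by have := late m i li; lia.
  + by have := late m j lj; lia.
  + by rewrite i_n.
- exact: prefix_prefix.
rewrite /t onth_cat ltnNge size_n /= onthE map_rcons nth_rcons.
by rewrite size_map size_nseq ltnn eqxx.
Qed.

Lemma sparse_tree_branch (d : nat -> nat) (x : cantor_space) :
  branches (sparse_tree d) x -> forall m i j,
  d m <= i < d m.+1 -> d m <= j < d m.+1 -> x i -> x j -> i = j.
Proof.
move=> bx m i j im jm xi xj.
by apply: (bx (d m.+1) m) => //; rewrite nth_mkseq //; lia.
Qed.

(** * Sums of branches leave a block intact *)

Definition few_blocks_changed (c : nat -> nat) (n : nat) (x y : cantor_space) :=
  forall m, exists r : seq nat, size r <= n /\
    forall k, m ^ 2 <= k < m.+1 ^ 2 -> k \notin r ->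
      agree (c k) (c k.+1) x y.

(** A branch has at most one 1 in each superblock, so adding it can spoil only
    one more of its blocks. *)
Lemma add_iter_few_blocks_changed (c : nat -> nat) (F : set cantor_space) n x :
  (forall k, c k < c k.+1) ->
  add_iter F (branches (sparse_tree (fun m => c (m ^ 2)))) n x ->
  exists2 y, F y & few_blocks_changed c n x y.
Proof.
move=> cS; have cle := increasing_leq cS.
elim: n x => [|n IH] x; first by exists x => // m; exists [::].
move=> [x' /IH[y Fy x'y] [b /sparse_tree_branch bT <-]]; exists y => // m.
have [r [rn rP]] := x'y m.
have [[k0 [i0 [k0m i0k bi0]]]|nk] := pselect (exists k i,
    [/\ m ^ 2 <= k < m.+1 ^ 2, c k <= i < c k.+1 & b i]).
  exists (k0 :: r); split=> // k km; rewrite inE negb_or => /andP[kk0 kr] i ik.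
  rewrite /cantor_add (rP k) //; case bi: (b i); last by rewrite addbF.
  have in_m l j : m ^ 2 <= l < m.+1 ^ 2 -> c l <= j < c l.+1 ->
      c (m ^ 2) <= j < c (m.+1 ^ 2).
    by move=> /andP[/cle + /cle]; lia.
  have ii0 := bT m i i0 (in_m _ _ km ik) (in_m _ _ k0m i0k) bi bi0.
  by rewrite ii0 in ik; rewrite (block_unique cS ik i0k) eqxx in kk0.
exists r; split=> [|k km kr i ik]; first exact: leqW.
rewrite /cantor_add (rP k) //; case bi: (b i); last by rewrite addbF.
by case: nk; exists k, i.
Qed.

(** The m-th superblock has 2m+1 > n blocks. *)
Lemma unchanged_block (c : nat -> nat) n m x y : n <= m ->
  few_blocks_changed c n x y ->
  exists k, m ^ 2 <= k < m.+1 ^ 2 /\ agree (c k) (c k.+1) x y.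
Proof.
move=> nm /(_ m)[r [rn rP]]; apply: contrapT => none.
have sub : {subset iota (m ^ 2) (2 * m).+1 <= r}.
  move=> k; rewrite mem_iota => km; apply: contrapT => /negP kr.
  have km' : m ^ 2 <= k < m.+1 ^ 2 by lia.
  by apply: none; exists k; split=> //; apply: rP.
have := leq_trans (uniq_leq_size (iota_uniq _ _) sub) rn.
by rewrite size_iota; lia.
Qed.

(** * Points that keep differing from z *)

Lemma leq_sqr m : m <= m ^ 2.
Proof. by case: m => // m; rewrite expnS expn1 leq_pmulr. Qed.

Definition eventually_mismatched (c : nat -> nat) (z : cantor_space) j :=
  [set x : cantor_space | forall m, j <= m ->
    exists k, m ^ 2 <= k < m.+1 ^ 2 /\ ~ agree (c k) (c k.+1) x z].

Lemma avoidable_eventually_mismatched (c : nat -> nat) z j :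
  (forall k, c k < c k.+1) -> avoidable (eventually_mismatched c z j).
Proof.
move=> cS x a; have cle := increasing_leq cS.
pose m := maxn a j.
have am : a <= c (m ^ 2).
  apply: leq_trans (leq_maxl a j) _.
  exact: leq_trans (leq_sqr m) (increasing_geq cS _).
exists (fun i => if i < a then x i else z i), (c (m.+1 ^ 2)); split.
- apply: leq_trans am _; apply: cle; lia.
- by move=> i /andP[_ ->].
move=> w wz /(_ m (leq_maxr _ _))[k [km]]; apply=> i ik.
have := cle (m ^ 2) k; have := cle k.+1 (m.+1 ^ 2) => h1 h2.
rewrite wz; last by lia.
by case: ltnP => //; lia.
Qed.

Theorem theorem7 (F : set cantor_space) (hF : meager F) :
  exists T : set (seq bool), splitting_tree T /\
    forall n : nat, meager (add_iter F (branches T) n).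
Proof.
have [N [ndN ->]] := hF.
have aN j := nowhere_dense_avoidable (ndN j).
have [c [z [cS cz]]] := dodging_blocks aN.
pose d m := c (m ^ 2).
have dS m : d m < d m.+1.
  by apply: leq_trans (cS _) _; apply: increasing_leq => //; lia.
exists (sparse_tree d); split; first exact: sparse_tree_splitting.
move=> n; set S := add_iter _ _ _.
(* Meager sets being exact unions of nowhere dense ones, the covering pieces are
   cut down to S. *)
exists (fun j => S `&` eventually_mismatched c z j); split=> [j|].
  apply: avoidable_nowhere_dense => x a.
  have [y [b [ab xy yM]]] := avoidable_eventually_mismatched z j cS x a.
  by exists y, b; split=> // w /yM + [_].
apply/seteqP; split=> x; last by case=> j _ [].
move=> Sx; have [y [j _ Nj] xy] := add_iter_few_blocks_changed cS Sx.
(* From m = n on some block is left intact by the n branches; from m = j on the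
   point y of N_j differs from z on every block of J_m: k >= m^2 >= m >= j. *)
exists (maxn j n) => //; split=> // m; rewrite geq_max => /andP[jm nm].
have [k [km xyk]] := unchanged_block nm xy; exists k; split=> // xz.
have jk : j <= k by have := leq_sqr m; lia.
apply: (cz j k y jk Nj) => i ik; by rewrite -xyk ?xz.
Qed.
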